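(* Let $S$ be an integral domain, $\sigma\in\mathrm{Aut}(S)$ of finite order $m$, $n\ge2$ an integer, and $a,b\in S^\times$. If $m\nmid n$, then any nonzero ring homomorphism $G:\mathbb{S}_{t^n-a}\to\mathbb{S}_{t^n-b}$ whose restriction to $S$ is given by some automorphism $\tau\in\mathrm{Aut}(S)$ commuting with $\sigma$ must be monomial of degree one, i.e. $G(t)=\alpha t$ for some nonzero $\alpha\in S$.
   Context: $S[t;\sigma]$ is the skew polynomial ring with $tc=\sigma(c)t$ for $c\in S$. For a monic $f\in S[t;\sigma]$ of degree $n$, every $g\in S[t;\sigma]$ can be written uniquely as $g=qf+r$ with $\deg r<n$; write $r=g \bmod_r f$. The Petit ring $\mathbb{S}_f$ is the additive group of skew polynomials of degree $<n$ with multiplication $g\circ h=gh \bmod_r f$; it is a unital, in general nonassociative, ring containing $S$ as the constants. *)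

(* Defs.v *)
From HB Require Import structures.
From mathcomp Require Import all_boot all_order all_algebra zify.

Set Implicit Arguments.
Unset Strict Implicit.
Unset Printing Implicit Defensive.

Import GRing.Theory.
Local Open Scope ring_scope.

(* The order of sigma as an element of the group Aut(S). *)
Definition has_order (T : Type) (sigma : T -> T) (m : nat) : Prop :=
  [/\ (0 < m)%N, iter m sigma =1 id &
      forall k, (0 < k < m)%N -> ~ (iter k sigma =1 id)].

(* S[t; sigma]: its elements are the polynomials over S, written with the     *)
(* coefficients on the left of the powers of t. Only the product differs from *)
(* that of {poly S}; it is forced by t^j * c = sigma^j(c) * t^j.              *)
Definition skewpoly (S : nzRingType) (sigma : {rmorphism S -> S}) : Type :=
  {poly S}.

Section SkewRing.

Variables (S : nzRingType) (sigma : {rmorphism S -> S}).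
Local Notation R := (skewpoly sigma).
Implicit Types p q r : {poly S}.

HB.instance Definition _ := GRing.Zmodule.on R.

Definition smul p q : {poly S} :=
  \poly_(i < (size p + size q).-1)
     \sum_(j < i.+1) p`_j * iter j sigma q`_(i - j).

Lemma iter_rmorphB k : {morph iter k sigma : x y / x - y}.
Proof. by elim: k => [|k IH] x y //=; rewrite IH rmorphB. Qed.

Lemma iter_rmorphM k : {morph iter k sigma : x y / x * y}.
Proof. by elim: k => [|k IH] x y //=; rewrite IH rmorphM. Qed.

Lemma iter_rmorph1 k : iter k sigma 1 = 1.
Proof. by elim: k => //= k ->; rewrite rmorph1. Qed.

Lemma iter_rmorph0 k : iter k sigma 0 = 0.
Proof. by elim: k => //= k ->; rewrite rmorph0. Qed.

Lemma iter_rmorphD k : {morph iter k sigma : x y / x + y}.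
Proof. by elim: k => [|k IH] x y //=; rewrite IH rmorphD. Qed.

Lemma iter_rmorph_sum k I (s : seq I) (P : pred I) (F : I -> S) :
  iter k sigma (\sum_(i <- s | P i) F i) =
  \sum_(i <- s | P i) iter k sigma (F i).
Proof. exact: (big_morph _ (iter_rmorphD k) (iter_rmorph0 k)). Qed.

Lemma coef_smul p q i :
  (smul p q)`_i = \sum_(j < i.+1) p`_j * iter j sigma q`_(i - j).
Proof.
rewrite coef_poly ltn_predRL; case: leqP => // le_pq_i1.
rewrite big1 // => j _; have [lq_p_j|lt_j_p] := leqP (size p) j.
  by rewrite nth_default ?mul0r.
rewrite [q`__]nth_default ?iter_rmorph0 ?mulr0 // leq_subRL -ltnS //.
by rewrite (leq_trans _ le_pq_i1) // ltn_add2r.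
Qed.

Lemma coef_smul_rev p q i :
  (smul p q)`_i = \sum_(j < i.+1) p`_(i - j) * iter (i - j) sigma q`_j.
Proof.
rewrite coef_smul (reindex_inj rev_ord_inj) /=.
by apply: eq_bigr => j _; rewrite (sub_ordK j).
Qed.

Lemma smulA : associative smul.
Proof.
move=> p q r; apply/polyP=> i; rewrite coef_smul coef_smul_rev.
pose coef3 j k :=
  p`_j * (iter j sigma q`_(i - j - k) * iter (i - k) sigma r`_k).
transitivity (\sum_(j < i.+1) \sum_(k < i.+1 | (k <= i - j)%N) coef3 j k).
  apply: eq_bigr => /= j _.
  rewrite coef_smul_rev iter_rmorph_sum big_distrr /=.
  rewrite (big_ord_narrow_leq (leq_subr _ _)); apply: eq_bigr => k _.
  rewrite /coef3 /= iter_rmorphM -iterD; congr (_ * (_ * iter _ _ _)).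
  rewrite addnBA; last by rewrite -ltnS.
  by rewrite subnKC // -ltnS.
rewrite (exchange_big_dep predT) //=; apply: eq_bigr => k _.
transitivity (\sum_(j < i.+1 | (j <= i - k)%N) coef3 j k).
  apply: eq_bigl => j; rewrite -ltnS -(ltnS j) -!subSn ?leq_ord //.
  by rewrite -subn_gt0 -(subn_gt0 j) -!subnDA addnC.
rewrite (big_ord_narrow_leq (leq_subr _ _)) coef_smul big_distrl /=.
by apply: eq_bigr => j _; rewrite /coef3 -!subnDA addnC mulrA.
Qed.

Lemma smul1p : left_id 1%:P smul.
Proof.
move=> p; apply/polyP => i; rewrite coef_smul big_ord_recl subn0.
by rewrite big1 => [|j _]; rewrite coefC !(mul1r, mul0r, addr0).
Qed.

Lemma smulp1 : right_id 1%:P smul.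
Proof.
move=> p; apply/polyP => i; rewrite coef_smul_rev big_ord_recl subn0 coefC.
by rewrite iter_rmorph1 big1 => [|j _]; rewrite ?coefC
   ?iter_rmorph0 !(mulr1, mulr0, addr0).
Qed.

Lemma smulDl : left_distributive smul +%R.
Proof.
move=> p q r; apply/polyP=> i; rewrite coefD !coef_smul -big_split.
by apply: eq_bigr => j _; rewrite coefD mulrDl.
Qed.

Lemma smulDr : right_distributive smul +%R.
Proof.
move=> p q r; apply/polyP=> i; rewrite coefD !coef_smul -big_split.
by apply: eq_bigr => j _; rewrite coefD iter_rmorphD mulrDr.
Qed.

Lemma sone_neq0 : (1%:P : {poly S}) != 0.
Proof. by rewrite polyC_eq0 oner_neq0. Qed.

HB.instance Definition _ := GRing.Zmodule_isNzRing.Build R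
  smulA smul1p smulp1 smulDl smulDr sone_neq0.

Definition skewC (c : S) : R := c%:P.
Definition skewX : R := 'X.

(* One plus the degree, and 0 for the zero skew polynomial. *)
Definition ssize (p : R) : nat := size (polyseq p).
Arguments ssize p%_R.

Lemma ssize0 : ssize 0 = 0%N.
Proof. exact: size_poly0. Qed.

Lemma ssizeB (p q : R) : (ssize (p - q) <= maxn (ssize p) (ssize q))%N.
Proof. by rewrite -[ssize q]size_polyN; apply: size_polyD. Qed.

Lemma ssizeD (p q : R) : (ssize (p + q) <= maxn (ssize p) (ssize q))%N.
Proof. exact: size_polyD. Qed.

Lemma ssize_gt0 (p : R) : (0 < ssize p)%N = (p != 0).
Proof. exact: size_poly_gt0. Qed.

Lemma skewME (p q : R) : (p * q : R) = smul p q :> {poly S}.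
Proof. by []. Qed.

Lemma skewCM (c : S) (p : R) : (skewC c * p : R) = c *: (p : {poly S}) :> {poly S}.
Proof.
apply/polyP=> i; rewrite skewME coef_smul coefZ big_ord_recl subn0 coefC /=.
by rewrite big1 ?addr0 // => j _; rewrite coefC mul0r.
Qed.

Lemma coef_smulXn k p i : (smul 'X^k p)`_i =
  if (i < k)%N then 0 else iter k sigma p`_(i - k).
Proof.
rewrite coef_smul; have [lt_ik | le_ki] := ltnP i k.
  rewrite big1 // => j _.
  by rewrite coefXn (ltn_eqF (leq_ltn_trans _ lt_ik)) ?mul0r // -ltnS.
rewrite (bigD1 (inord k)) //= big1 ?addr0 => [|j]; last first.
  rewrite -val_eqE /= inordK ?ltnS // coefXn => /negPf->.
  by rewrite mul0r.
by rewrite inordK ?ltnS // coefXn eqxx mul1r.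
Qed.

Lemma skewXnE k : (skewX ^+ k : R) = 'X^k :> {poly S}.
Proof.
elim: k => [|k IH]; first by rewrite !expr0.
rewrite exprSr skewME IH; apply/polyP=> i.
rewrite coef_smulXn coefXn coefX.
have [lt_ik | le_ki] := ltnP i k; first by rewrite (ltn_eqF (ltnW _)).
rewrite -(eqn_add2r k) subnK // add1n.
by case: eqP; rewrite ?iter_rmorph0 ?iter_rmorph1.
Qed.

Lemma coef_skewXnM k (p : R) i : ((skewX ^+ k * p : R) : {poly S})`_i =
  if (i < k)%N then 0 else iter k sigma (p : {poly S})`_(i - k).
Proof. by rewrite skewME skewXnE coef_smulXn. Qed.

Lemma skewXC (c : S) : skewX * skewC c = skewC (sigma c) * skewX.
Proof.
apply/polyP=> i; rewrite -[in LHS](expr1 skewX).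
rewrite [LHS](coef_skewXnM 1) skewCM coefZ coefX coefC /=.
by case: i => [|[|i]] //=; rewrite ?mulr0 ?mulr1 ?rmorph0.
Qed.

Lemma skewC_additive c d : skewC (c + d) = skewC c + skewC d.
Proof. exact: polyCD. Qed.

Lemma skewC_mul c d : skewC (c * d) = skewC c * skewC d.
Proof. by rewrite {1}/skewC polyCM mul_polyC [RHS]skewCM. Qed.

Fixpoint rmod_rec (f : R) (k : nat) (g : R) : R :=
  if (ssize g < ssize f)%N then g
  else if k is k'.+1 then
    rmod_rec f k' (g - skewC (lead_coef g) *
      skewX ^+ (ssize g - ssize f) * f)
  else g.

(* g mod_r f, characterized by rmodP and rmod_uniq; 0 is a dummy value. *)
Definition rmod (g f : R) : R :=
  if (f : {poly S}) \is monic then rmod_rec f (ssize g) g else 0.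

Lemma size_skew_step (f g : R) : (f : {poly S}) \is monic ->
  (ssize f <= ssize g)%N ->
  (ssize (g - skewC (lead_coef g) * skewX ^+ (ssize g - ssize f) * f)
     < ssize g)%N.
Proof.
move=> fm le_fg; have f0 : (0 < ssize f)%N by rewrite ssize_gt0 monic_neq0.
have g0 := leq_trans f0 le_fg.
rewrite -[X in (_ < X)%N](prednK g0) ltnS; apply/leq_sizeP => j le_gj.
rewrite coefB -mulrA skewCM coefZ coef_skewXnM.
have -> : (j < ssize g - ssize f)%N = false by lia.
have [->|ne] := eqVneq j (ssize g).-1.
  have -> : ((ssize g).-1 - (ssize g - ssize f))%N = (ssize f).-1 by lia.
  by rewrite -[f`__]/(lead_coef f) (monicP fm) iter_rmorph1 mulr1 subrr.
rewrite nth_default; last by rewrite -/(ssize g); lia.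
by rewrite [f`__]nth_default ?iter_rmorph0 ?mulr0 ?subrr // -/(ssize f); lia.
Qed.

Lemma rmod_recP (f : R) k (g : R) : (f : {poly S}) \is monic ->
  (ssize g <= k)%N ->
  (exists q : R, g = q * f + rmod_rec f k g) /\
  (ssize (rmod_rec f k g) < ssize f)%N.
Proof.
move=> fm; elim: k g => [|k IH] g le_gk /=.
  have [lt_gf|le_fg] := ltnP; first by split=> //; exists 0; rewrite mul0r add0r.
  by move: (leq_trans le_fg le_gk); rewrite leqn0 size_poly_eq0
    (negPf (monic_neq0 fm)).
have [lt_gf|le_fg] := ltnP; first by split=> //; exists 0; rewrite mul0r add0r.
set g' := g - _.
have lt_g' : (ssize g' < ssize g)%N.
  exact: size_skew_step.
have [|[q eq_g'] ->] := IH g'; first by rewrite -ltnS (leq_trans lt_g').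
split=> //; exists (q + skewC (lead_coef g) *
      skewX ^+ (ssize g - ssize f)).
by rewrite mulrDl addrAC -eq_g' subrK.
Qed.

Lemma rmodP (g f : R) : (f : {poly S}) \is monic ->
  (exists q : R, g = q * f + rmod g f) /\
  (ssize (rmod g f) < ssize f)%N.
Proof. by move=> fm; rewrite /rmod fm; apply: rmod_recP. Qed.

Lemma size_skewM_monic (q f : R) : (f : {poly S}) \is monic -> q != 0 ->
  (ssize f <= ssize (q * f))%N.
Proof.
move=> fm q0; have sf : (0 < ssize f)%N by rewrite ssize_gt0 monic_neq0.
have sq : (0 < ssize q)%N by rewrite ssize_gt0.
pose k := (ssize q).-1; pose i := (k + (ssize f).-1)%N.
have ci : ((q * f : R) : {poly S})`_i != 0.
  rewrite skewME coef_smul (bigD1 (inord k)) //=.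
  rewrite inordK ?ltnS ?leq_addr // /i addKn.
  rewrite -/(lead_coef f) (monicP fm) iter_rmorph1 mulr1.
  rewrite big1 ?addr0 => [|j]; first by rewrite -/(lead_coef q) lead_coef_eq0.
  rewrite -val_eqE /= inordK ?ltnS ?leq_addr // => ne.
  have [lt_jk | le_kj] := ltnP j k.
    rewrite [f`__]nth_default ?iter_rmorph0 ?mulr0 // -/(ssize f); lia.
  rewrite nth_default ?mul0r // -/(ssize q).
  by move: ne le_kj; rewrite /k; lia.
have: (i < ssize (q * f))%N.
  by rewrite ltnNge; apply: contra ci => /leq_sizeP->.
by rewrite /i /k; lia.
Qed.

Lemma rmod_uniq (g f q r : R) : (f : {poly S}) \is monic ->
  g = q * f + r -> (ssize r < ssize f)%N ->
  r = rmod g f.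
Proof.
move=> fm eq_g lt_r; have [[q' eq_g'] lt_r'] := rmodP g fm.
have eq_r : rmod g f - r = (q - q') * f.
  have -> : rmod g f = g - q' * f by rewrite [in RHS]eq_g' addrAC subrr add0r.
  by rewrite [in LHS]eq_g mulrBl addrAC addrK.
have [q0|qn0] := eqVneq (q - q') 0.
  by apply/esym/eqP; rewrite -subr_eq0 eq_r q0 mul0r.
have := size_skewM_monic fm qn0; rewrite -eq_r leqNgt.
by rewrite (leq_ltn_trans (ssizeB _ _)) // gtn_max lt_r' lt_r.
Qed.

Lemma rmod_small (g f : R) : (f : {poly S}) \is monic ->
  (ssize g < ssize f)%N -> rmod g f = g.
Proof.
move=> fm lt_g; apply/esym/(@rmod_uniq _ _ 0) => //.
by rewrite mul0r add0r.
Qed.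

Lemma rmodD (g h f : R) : rmod (g + h) f = rmod g f + rmod h f.
Proof.
have [fm | /negPf nfm] := boolP ((f : {poly S}) \is monic); last first.
  by rewrite /rmod nfm addr0.
have [[q eq_g] lt_g] := rmodP g fm; have [[q' eq_h] lt_h] := rmodP h fm.
apply/esym/(@rmod_uniq _ _ (q + q')) => //.
  by rewrite mulrDl addrACA -eq_g -eq_h.
by rewrite (leq_ltn_trans (ssizeD _ _)) // gtn_max lt_g lt_h.
Qed.

Section Petit.

Variable f : R.

(* deg p < deg f *)
Definition deg_lt : {pred R} :=
  fun p : R => (ssize p <= (ssize f).-1)%N.

Lemma deg_lt_zmod : zmod_closed deg_lt.
Proof.
split=> [|p q]; rewrite !unfold_in /= /deg_lt ?ssize0 // => hp hq.
by rewrite (leq_trans (ssizeB _ _)) // geq_max hp hq.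
Qed.

HB.instance Definition _ := GRing.isZmodClosed.Build R deg_lt deg_lt_zmod.

Lemma rmod_deg_lt g : rmod g f \in deg_lt.
Proof.
rewrite unfold_in /deg_lt /rmod; case: ifP => [fm|_]; last by rewrite ssize0.
have [_ lt_r] := @rmod_recP f _ g fm (leqnn _).
by rewrite -ltnS prednK // ssize_gt0 monic_neq0.
Qed.

(* The Petit ring S_f; its nonassociative product is petit_mul, not *%R. *)
Record petit : Type := Petit { petit_val : R; _ : petit_val \in deg_lt }.

HB.instance Definition _ := [isSub for petit_val].
HB.instance Definition _ := [Choice of petit by <:].
HB.instance Definition _ := [SubChoice_isSubZmodule of petit by <:].

Definition to_petit (g : R) : petit := Petit (rmod_deg_lt g).

Definition petit_mul (x y : petit) : petit :=
  to_petit (petit_val x * petit_val y).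

(* For monic f these are c and t themselves as soon as deg f >= 1 (petit_valC)*)
(* and deg f >= 2 (petit_valX), respectively.                                 *)
Definition petitC (c : S) : petit := to_petit (skewC c).
Definition petitX : petit := to_petit skewX.

Lemma petit_mulDl : left_distributive petit_mul +%R.
Proof. by move=> x y z; apply: val_inj; rewrite /= mulrDl rmodD. Qed.

Lemma petit_mulDr : right_distributive petit_mul +%R.
Proof. by move=> x y z; apply: val_inj; rewrite /= mulrDr rmodD. Qed.

Lemma petit_valC c : (f : {poly S}) \is monic ->
  (1 < ssize f)%N -> petit_val (petitC c) = skewC c.
Proof.
by move=> fm lt1f; rewrite /= rmod_small // (leq_ltn_trans (size_polyC_leq1 c)).
Qed.

Lemma petit_valX : (f : {poly S}) \is monic ->
  (2 < ssize f)%N -> petit_val petitX = skewX.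
Proof. by move=> fm lt2f; rewrite /= rmod_small // [ssize _]size_polyX. Qed.

Lemma petit_val_small (x : petit) : (f : {poly S}) \is monic ->
  rmod (petit_val x) f = petit_val x.
Proof.
move=> fm; apply: rmod_small => //; case: x => x /=.
rewrite unfold_in /deg_lt => le_x.
by rewrite -[X in (_ < X)%N]prednK ?ltnS // ssize_gt0 monic_neq0.
Qed.

Lemma petit_mul1x : (f : {poly S}) \is monic ->
  (1 < ssize f)%N -> left_id (petitC 1) petit_mul.
Proof.
move=> fm lt1f x; apply: val_inj => /=.
by rewrite -[rmod (skewC 1) f]/(petit_val (petitC 1)) petit_valC //
   mul1r petit_val_small.
Qed.

Lemma petit_mulx1 : (f : {poly S}) \is monic ->
  (1 < ssize f)%N -> right_id (petitC 1) petit_mul.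
Proof.
move=> fm lt1f x; apply: val_inj => /=.
by rewrite -[rmod (skewC 1) f]/(petit_val (petitC 1)) petit_valC //
   mulr1 petit_val_small.
Qed.

End Petit.

(* Homomorphisms of nonassociative rings, not assumed to be unital. *)
Definition petit_hom (f g : R) (G : petit f -> petit g) : Prop :=
  {morph G : x y / x + y} /\ {morph G : x y / petit_mul x y}.

Definition skew_binom (n : nat) (a : S) : R := skewX ^+ n - skewC a.

Lemma size_binom n a : (0 < n)%N -> ssize (skew_binom n a) = n.+1.
Proof. by move=> n0; rewrite /ssize /skew_binom skewXnE (size_XnsubC a n0). Qed.

Lemma binom_monic n a : (0 < n)%N -> (skew_binom n a : {poly S}) \is monic.
Proof. by move=> n0; rewrite /skew_binom skewXnE monicXnsubC. Qed.

End SkewRing.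

Arguments skew_binom {S} sigma n a.
Arguments skewX {S} sigma.
Arguments skewC {S} sigma c.
Arguments petitX {S sigma} f.
Arguments petitC {S sigma} f c.

(* Main.v *)
(* The relation t c = sigma(c) t forces G(t^k), for k < n, to be supported in *)
(* degrees congruent to k modulo m. Let d be the degree of g = G(t), which is *)
(* nonzero because t t^(n-1) = a is mapped to a unit; then d = 1 modulo m, so *)
(* d > 0. If the product g G(t^k), of degree (k+1)d, wrapped around t^n = b,  *)
(* then G(t^(k+1)) would have a nonzero coefficient in degree (k+1)d - n,     *)
(* which is not congruent to k+1 as m does not divide n. Hence nothing wraps, *)
(* G(t^(n-1)) has degree (n-1)d < n, and d = 1.                               *)
Require Import Defs.
From mathcomp Require Import all_boot all_order all_algebra zify.

Set Implicit Arguments.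
Unset Strict Implicit.
Unset Printing Implicit Defensive.

Import GRing.Theory.
Local Open Scope ring_scope.

(** The residue of the exponent modulo [m] grades the situation. In a domain, comparing coefficients
    in x c = sigma^k(c) x shows that every exponent i of x satisfies sigma^i = sigma^k, hence i = k
    modulo [m] ([petit_twist_supp]); skew products respect this grading ([coef_smul_supp]).
    Reduction by t^n - b moves degree i + n to degree i ([coef_petit_mul_binom]), which breaks the
    grading because [m] does not divide [n]. So the top term of G(t) G(t^k) cannot wrap, degrees add
    up, and deg G(t^(n-1)) = (n-1) deg G(t) must stay below n. *)

(** Cancelling the smaller iterate leaves s^(j-i) = id; the remainder of j - i modulo [m] is then an
    exponent below the order, so it is 0. *)
Lemma iter_eq_mod (T : Type) (s : T -> T) (m i j : nat) :
  injective s -> has_order s m -> iter i s =1 iter j s -> i = j %[mod m].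
Proof.
move=> s_inj [m_gt0 s_m s_lt].
have iter_inj k : injective (iter k s).
  by elim: k => [|k IH] x y //= /s_inj/IH.
wlog le_ij : i j / (i <= j)%N => [wl|].
  by case: (leqP i j) => [|/ltnW] le_ij eq_ij; [|symmetry]; apply: wl.
move=> eq_ij; apply/esym/eqP; rewrite eqn_mod_dvd //.
set r := (j - i)%N.
have s_r x : iter r s x = x.
  by apply: (iter_inj i); rewrite -iterD subnKC // eq_ij.
have s_mq q x : iter (q * m) s x = x.
  by elim: q x => // q IH x; rewrite mulSn iterD IH s_m.
rewrite /dvdn -leqn0 leqNgt; apply/negP => r_gt0.
apply: (s_lt (r %% m)%N); first by rewrite r_gt0 ltn_pmod.
by move=> x; rewrite -[RHS]s_r {2}(divn_eq r m) iterD s_mq.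
Qed.

Lemma iter_rmorph_eq0 (S : nzRingType) (sigma : {rmorphism S -> S}) k x :
  injective sigma -> (iter k sigma x == 0) = (x == 0).
Proof.
move=> s_inj; elim: k => //= k <-.
by rewrite -{1}(rmorph0 sigma) (inj_eq s_inj).
Qed.

Lemma size_smul_leq (S : nzRingType) (sigma : {rmorphism S -> S})
  (p q : {poly S}) : (size (smul sigma p q) <= (size p + size q).-1)%N.
Proof. exact: size_poly. Qed.

Lemma coef_smul_top (S : nzRingType) (sigma : {rmorphism S -> S})
    (p q : {poly S}) (d e : nat) : (size p <= d.+1)%N -> (size q <= e.+1)%N ->
  (smul sigma p q)`_(d + e) = p`_d * iter d sigma q`_e.
Proof.
move=> sp sq; rewrite coef_smul (bigD1 (inord d)) //=.
rewrite inordK ?ltnS ?leq_addr // addKn big1 ?addr0 // => j.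
rewrite -val_eqE /= inordK ?ltnS ?leq_addr // => ne.
have [lt_jd | le_dj] := ltnP j d.
  rewrite [q`__]nth_default ?iter_rmorph0 ?mulr0 //.
  by apply: leq_trans sq _; lia.
rewrite nth_default ?mul0r //; apply: leq_trans sp _; lia.
Qed.

Lemma coef_smulC (S : nzRingType) (sigma : {rmorphism S -> S})
    (p : {poly S}) c i : (smul sigma p c%:P)`_i = p`_i * iter i sigma c.
Proof.
rewrite coef_smul_rev big_ord_recl subn0 coefC /= big1 ?addr0 // => j _.
by rewrite coefC iter_rmorph0 mulr0.
Qed.

(** A nonzero coefficient needs a nonzero term p_j sigma^j(q_(e-j)), and the residues of j and e - j
    add up. *)
Lemma coef_smul_supp (S : nzRingType) (sigma : {rmorphism S -> S})
    (p q : {poly S}) (m k l e : nat) :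
  (forall i, p`_i != 0 -> i = k %[mod m]) ->
  (forall i, q`_i != 0 -> i = l %[mod m]) ->
  (smul sigma p q)`_e != 0 -> e = k + l %[mod m].
Proof.
move=> supp_p supp_q /eqP; rewrite coef_smul => nz.
have [//|ne] := eqVneq (e %% m)%N ((k + l) %% m)%N.
case: nz; apply: big1 => j _.
have [->|/supp_p pj] := eqVneq p`_j 0; first by rewrite mul0r.
have [->|/supp_q qj] := eqVneq q`_(e - j) 0.
  by rewrite iter_rmorph0 mulr0.
case/eqP: ne; rewrite -modnDm -pj -qj modnDm subnKC //.
by rewrite -ltnS.
Qed.

(** Since c t^(i+n) = c t^i (t^n - b) + c sigma^i(b) t^i, one reduction folds the upper half of [p]
    onto the lower; the bound 2n on the size makes one enough. *)
Lemma coef_rmod_binom (S : nzRingType) (sigma : {rmorphism S -> S}) n (b : S)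
    (p : skewpoly sigma) i : (0 < n)%N -> (ssize p <= n + n)%N -> (i < n)%N ->
  (rmod p (skew_binom sigma n b) : {poly S})`_i =
    (p : {poly S})`_i + (p : {poly S})`_(i + n) * iter i sigma b.
Proof.
move=> n_gt0 sp lt_in.
(* The division is written down explicitly, with the upper half of [p], shifted down by [n], as
   quotient; uniqueness does the rest. *)
pose r : {poly S} := \poly_(j < n) (p`_j + p`_(j + n) * iter j sigma b).
pose q : {poly S} := drop_poly n p.
rewrite -(@rmod_uniq _ _ p (skew_binom sigma n b) q r) ?binom_monic //.
- by rewrite coef_poly lt_in.
- apply/polyP => j; rewrite coefD /skew_binom mulrBr coefB !skewME coef_smulC.
  rewrite skewXnE [r`_j]coef_poly coef_drop_poly.
  have -> : (smul sigma q 'X^n)`_j = if (j < n)%N then 0 else p`_j.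
    rewrite coef_smul_rev; case: ltnP => [lt_jn | le_nj].
      rewrite big1 // => k _.
      have -> : 'X^n`_k = 0 :> S.
        by rewrite coefXn ltn_eqF // (leq_ltn_trans _ lt_jn) // -ltnS.
      by rewrite iter_rmorph0 mulr0.
    rewrite (bigD1 (inord n)) //= inordK ?ltnS // coefXn eqxx iter_rmorph1.
    rewrite mulr1 coef_drop_poly subnK // big1 ?addr0 // => k.
    rewrite -val_eqE /= inordK ?ltnS // coefXn => /negPf->.
    by rewrite iter_rmorph0 mulr0.
  case: ltnP => [lt_jn | le_nj]; first by rewrite sub0r addrC addrK.
  rewrite [p`_(j + n)]nth_default ?mul0r ?subr0 ?addr0 //.
  by rewrite (leq_trans sp) ?leq_add2r.
- by rewrite size_binom // ltnS size_poly.
Qed.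

Lemma ssize_petit_binom (S : nzRingType) (sigma : {rmorphism S -> S}) n (b : S)
    (x : petit (skew_binom sigma n b)) :
  (0 < n)%N -> (ssize (petit_val x) <= n)%N.
Proof.
by move=> n_gt0; case: x => x /=; rewrite unfold_in /deg_lt size_binom.
Qed.

Lemma coef_petit_mul_binom (S : nzRingType) (sigma : {rmorphism S -> S}) n
    (b : S) (x y : petit (skew_binom sigma n b)) i : (0 < n)%N -> (i < n)%N ->
  (petit_val (petit_mul x y) : {poly S})`_i =
    (smul sigma (petit_val x) (petit_val y))`_i +
    (smul sigma (petit_val x) (petit_val y))`_(i + n) * iter i sigma b.
Proof.
move=> n_gt0 lt_in; rewrite /= coef_rmod_binom //.
apply: leq_trans (size_smul_leq _ _ _) _.
have := ssize_petit_binom x n_gt0; have := ssize_petit_binom y n_gt0.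
by rewrite /ssize; lia.
Qed.

(** The identity already holds in S[t; sigma], where c passes one t at a time; both sides are then
    reduced. *)
Lemma petit_mulC_twist (S : nzRingType) (sigma : {rmorphism S -> S}) n (a : S)
    k c : (1 < n)%N -> (k < n)%N ->
  let f := skew_binom sigma n a in
  petit_mul (to_petit f (skewX sigma ^+ k)) (petitC f c) =
  petit_mul (petitC f (iter k sigma c)) (to_petit f (skewX sigma ^+ k)).
Proof.
move=> n_gt1 lt_kn f.
have n_gt0 := ltnW n_gt1.
have fm : (f : {poly S}) \is monic by apply: binom_monic.
have sf : ssize f = n.+1 by apply: size_binom.
apply: val_inj; apply: (congr1 (fun g => rmod g f)).
rewrite !(petit_valC _ fm) ?sf //= (rmod_small fm); last first.
  by rewrite sf skewXnE /ssize size_polyXn ltnS.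
elim: k {lt_kn} c => [|k IH] c.
  by rewrite expr0 mul1r mulr1.
by rewrite exprSr -mulrA skewXC mulrA IH -mulrA -iterSr.
Qed.

Lemma petit_twist_supp (S : idomainType) (sigma : {rmorphism S -> S}) m n
    (b : S) k (x : petit (skew_binom sigma n b)) i :
  injective sigma -> has_order sigma m -> (1 < n)%N ->
  (forall c, petit_mul x (petitC (skew_binom sigma n b) c) =
             petit_mul (petitC (skew_binom sigma n b) (iter k sigma c)) x) ->
  (petit_val x : {poly S})`_i != 0 -> i = k %[mod m].
Proof.
move=> s_inj s_ord n_gt1 x_tw xi; apply: (iter_eq_mod s_inj s_ord) => c.
have n_gt0 := ltnW n_gt1.
have lt_in : (i < n)%N.
  rewrite ltnNge; apply: contra xi => le_ni; apply/eqP/nth_default.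
  exact: leq_trans (ssize_petit_binom x n_gt0) le_ni.
(* Against a constant factor nothing wraps around. *)
have xin : (petit_val x : {poly S})`_(i + n) = 0.
  apply: nth_default; rewrite (leq_trans (ssize_petit_binom x n_gt0)) //.
  exact: leq_addl.
set f := skew_binom sigma n b in x x_tw xi xin *.
have fm : (f : {poly S}) \is monic by apply: binom_monic.
have : (petit_val (petit_mul x (petitC f c)) : {poly S})`_i =
    (petit_val (petit_mul (petitC f (iter k sigma c)) x) : {poly S})`_i.
  by rewrite x_tw.
rewrite !coef_petit_mul_binom // !(petit_valC _ fm) ?size_binom //.
rewrite !coef_smulC -!skewME !skewCM !coefZ xin mul0r mulr0 mul0r !addr0.
by rewrite mulrC => /(mulIf xi).
Qed.

(** The product is not associative, so powers of t are taken in S[t; sigma] and then reduced. The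
    case k + 1 = n is included: it yields t t^(n-1) = a. *)
Lemma petit_mulX_exp (S : nzRingType) (sigma : {rmorphism S -> S}) n (a : S) k :
  (1 < n)%N -> (k < n)%N ->
  let f := skew_binom sigma n a in
  petit_mul (petitX f) (to_petit f (skewX sigma ^+ k)) =
  to_petit f (skewX sigma ^+ k.+1).
Proof.
move=> n_gt1 lt_kn f.
have n_gt0 := ltnW n_gt1.
have fm : (f : {poly S}) \is monic by apply: binom_monic.
have sf : ssize f = n.+1 by apply: size_binom.
apply: val_inj; rewrite /= exprS; congr (rmod (_ * _) f).
  by rewrite rmod_small // sf [ssize _]size_polyX.
by rewrite rmod_small // sf skewXnE [ssize _]size_polyXn.
Qed.

Lemma to_petit_Xn (S : nzRingType) (sigma : {rmorphism S -> S}) n (a : S) :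
  (0 < n)%N ->
  let f := skew_binom sigma n a in
  to_petit f (skewX sigma ^+ n) = petitC f a.
Proof.
move=> n_gt0 f; have fm : (f : {poly S}) \is monic by apply: binom_monic.
apply: val_inj; rewrite /= [RHS]rmod_small //; last first.
  by rewrite size_binom // ltnS (leq_trans (size_polyC_leq1 a)).
apply/esym/(@rmod_uniq _ _ _ _ 1) => //; first by rewrite mul1r subrK.
by rewrite size_binom // ltnS (leq_trans (size_polyC_leq1 a)).
Qed.

Theorem corollary6p2 (S : idomainType) (sigma : {rmorphism S -> S})
    (sigma_bij : bijective sigma) (m : nat) (sigma_order : has_order sigma m)
    (n : nat) (n_ge2 : (2 <= n)%N)
    (a b : S) (a_unit : a \is a GRing.unit) (b_unit : b \is a GRing.unit)
    (m_ndvd_n : ~~ (m %| n)%N)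
    (G : petit (skew_binom sigma n a) -> petit (skew_binom sigma n b))
    (G_hom : petit_hom G)
    (G_neq0 : exists x, G x != 0)
    (tau : {rmorphism S -> S}) (tau_bij : bijective tau)
    (tau_sigma : forall c, tau (sigma c) = sigma (tau c))
    (G_restr : forall c, G (petitC (skew_binom sigma n a) c) =
                         petitC (skew_binom sigma n b) (tau c)) :
  exists alpha : S, alpha != 0 /\
    petit_val (G (petitX (skew_binom sigma n a))) =
      skewC sigma alpha * skewX sigma.
Proof.
set f := skew_binom sigma n a in G G_hom G_neq0 G_restr *.
set h := skew_binom sigma n b in G G_hom G_neq0 G_restr *.
have [_ GM] := G_hom; have n_gt0 := ltnW n_ge2.
have s_inj := bij_inj sigma_bij; have [tau' tauK tau'K] := tau_bij.
have m_gt1 : (1 < m)%N.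
  have [m_gt0 _ _] := sigma_order; rewrite ltn_neqAle m_gt0 andbT.
  by apply: contra m_ndvd_n => /eqP <-; rewrite dvd1n.
have m_wrap k i : i = k %[mod m] -> i + n = k %[mod m] -> False.
  move=> ik; rewrite -modnDml ik modnDml -[in RHS](addn0 k) => /eqP.
  by rewrite eqn_modDl mod0n; apply/negP.
pose H k : {poly S} := petit_val (G (to_petit f (skewX sigma ^+ k))).
have sH k : (size (H k) <= n)%N by apply: ssize_petit_binom.
have supp k i : (k < n)%N -> (H k)`_i != 0 -> i = k %[mod m].
  move=> lt_kn; apply: (petit_twist_supp s_inj sigma_order n_ge2) => c.
  have tau_iter d : tau (iter k sigma d) = iter k sigma (tau d).
    by elim: (k) => //= j IH; rewrite tau_sigma IH.
  (* Surjectivity of [tau] makes every constant the image of a constant, so the twist relation of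
     t^k carries over to G(t^k). *)
  by rewrite -[c]tau'K -tau_iter -!G_restr -!GM petit_mulC_twist.
have H_step k i : (k < n)%N -> (i < n)%N -> (H k.+1)`_i =
    (smul sigma (H 1%N) (H k))`_i +
    (smul sigma (H 1%N) (H k))`_(i + n) * iter i sigma b.
  move=> lt_kn lt_in; rewrite /H -petit_mulX_exp // GM.
  by rewrite coef_petit_mul_binom // expr1.
have H1_neq0 : H 1%N != 0.
  apply/eqP => H1_0; have /eqP : G (petitC f a) = 0.
    have <- : petit_mul (petitX f) (to_petit f (skewX sigma ^+ n.-1)) =
        petitC f a.
      by rewrite petit_mulX_exp ?prednK // to_petit_Xn.
    rewrite GM.
    have -> : G (petitX f) = 0 by apply: val_inj; rewrite /= -H1_0 /H expr1.
    (* 0 y = 0 follows from left distributivity. *)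
    by apply: (addIr (petit_mul 0 (G (to_petit f (skewX sigma ^+ n.-1)))));
      rewrite -petit_mulDl !add0r.
  rewrite G_restr -(inj_eq val_inj) /= -[rmod _ _]/(petit_val (petitC h _)).
  rewrite petit_valC ?binom_monic ?size_binom // polyC_eq0 => /eqP tau_a.
  have := rmorph_unit tau a_unit.
  by rewrite tau_a unitr0.
pose d := (size (H 1%N)).-1.
have size_H1 : size (H 1%N) = d.+1 by rewrite prednK // size_poly_gt0.
have d_mod : d = 1 %[mod m].
  by apply: supp => //; rewrite -/(lead_coef _) lead_coef_eq0.
have size_H k : (k < n)%N -> size (H k) = (k * d).+1.
  elim: k => [|k IH] lt_kn.
    rewrite /H expr0 -/(skewC sigma 1) -/(petitC f 1) G_restr rmorph1.
    by rewrite petit_valC ?binom_monic ?size_binom // size_poly1.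
  have {}IH := IH (ltnW lt_kn).
  pose p := smul sigma (H 1%N) (H k); pose D := (d + k * d)%N.
  have pD : p`_D != 0.
    rewrite coef_smul_top ?size_H1 ?IH // mulf_neq0 //.
      by rewrite -/(lead_coef _) lead_coef_eq0.
    rewrite iter_rmorph_eq0 // -[(k * d)%N]/((k * d).+1.-1) -IH.
    by rewrite -/(lead_coef _) lead_coef_eq0 -size_poly_gt0 IH.
  have D_mod : D = k.+1 %[mod m].
    by rewrite /D -mulSn -modnMmr d_mod modnMmr muln1.
  have sp : (size p <= D.+1)%N.
    by apply: leq_trans (size_smul_leq _ _ _) _; rewrite size_H1 IH addnS.
  have [lt_Dn|le_nD] := ltnP D n.
    suff -> : H k.+1 = p.
      apply/eqP; rewrite mulSn -/D eqn_leq sp ltnNge.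
      by apply: contra pD => le_pD; apply/eqP/nth_default.
    apply/polyP => i; have [lt_in|le_ni] := ltnP i n.
      rewrite H_step ?(ltnW lt_kn) // -/p [p`_(i + n)]nth_default.
        by rewrite mul0r addr0.
      exact: leq_trans sp (leq_trans lt_Dn (leq_addl _ _)).
    rewrite !nth_default //; last by apply: leq_trans le_ni.
    exact: leq_trans sp (leq_trans lt_Dn le_ni).
  (* If the top term wraps, it lands in degree D - n, which is below [n] since d and k d are. *)
  have lt_en : (D - n < n)%N.
    rewrite ltn_subLR // -addSn leq_add //; first by rewrite -size_H1.
    by rewrite ltnW // -IH.
  case: (m_wrap k.+1 (D - n)%N); last by rewrite subnK.
  (* Either way D - n = k + 1 modulo [m]: if p_(D-n) is nonzero, by the grading of [p]; otherwise
     the coefficient of G(t^(k+1)) there is p_D sigma^(D-n)(b), nonzero as [b] is a unit. *)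
  have pe := coef_smul_supp (supp 1%N ^~ n_ge2) (supp k ^~ (ltnW lt_kn)).
  have [pe0|/pe//] := eqVneq p`_(D - n) 0.
  apply: supp => //; rewrite H_step ?(ltnW lt_kn) // -/p pe0 add0r subnK //.
  rewrite mulf_neq0 // iter_rmorph_eq0 //.
  by apply: contraTneq b_unit => ->; rewrite unitr0.
have d1 : d = 1%N.
  have d_gt0 : (0 < d)%N.
    by case: (d) d_mod => //; rewrite mod0n modn_small.
  apply/eqP; rewrite eqn_leq d_gt0 andbT -(@leq_pmul2l n.-1); last by lia.
  by have := sH n.-1; rewrite size_H ?ltn_predL // muln1; lia.
exists (H 1%N)`_1; split.
  by move: H1_neq0; rewrite -lead_coef_eq0 lead_coefE size_H1 d1.
rewrite skewCM; apply/polyP => i; rewrite coefZ coefX.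
have -> : petit_val (G (to_petit f (skewX sigma))) = H 1%N.
  by rewrite /H expr1.
have [->|i1] := eqVneq; first by rewrite mulr1.
rewrite mulr0; case: i i1 => [|[|i]] // _.
  (* The constant term vanishes because 0 and 1 differ modulo [m]. *)
  by apply/eqP/negPn/negP => /supp; rewrite mod0n modn_small // => /(_ n_ge2).
by rewrite nth_default // size_H1 d1.
Qed.
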